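(* Let $m,n$ be positive integers and let $q,z,u_1,\dots,u_n,v_1,\dots,v_m$ be complex parameters in general position. (I) For additional parameters $\eta_1,\dots,\eta_m$ (in general position), $$F_{n,m}^{trig(z)}(\overline u|\overline v)=\frac{1}{\prod_{1\le i<j\le m}(v_j-v_i)(\eta_i-\eta_j)}\det_{1\le i,j\le m}\Bigg(\prod_{k=1,k\ne j}^m(v_i-\eta_k)-z\prod_{k=1,k\ne j}^m(v_i-q\eta_k)\prod_{k=1}^n\frac{v_i-u_k}{v_i-qu_k}\Bigg).$$ (II) For additional parameters $\eta_1,\dots,\eta_n$ (in general position), $$G_{n,m}^{trig(z)}(\overline u|\overline v)=\frac{(z;q)_\infty}{(q^{m-n}z;q)_\infty}\,\frac{1}{\prod_{1\le i<j\le n}(u_j-u_i)(\eta_i-\eta_j)}\det_{1\le i,j\le n}\Bigg(\prod_{k=1,k\ne j}^n(u_i-\eta_k)-q^{m-n}z\prod_{k=1,k\ne j}^n(qu_i-\eta_k)\prod_{k=1}^m\frac{u_i-v_k}{qu_i-v_k}\Bigg).$$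
   Context: The factor $\frac{(z;q)_\infty}{(q^{m-n}z;q)_\infty}$ denotes $\prod_{j=0}^{m-n-1}(1-q^jz)$ if $n<m$, $1$ if $n=m$, and $\frac{1}{\prod_{j=1}^{n-m}(1-q^{-j}z)}$ if $n>m$. Write $[1,\dots,n]=\{1,\dots,n\}$, $|K|$ for the cardinality of a set $K$, $\overline u=\{u_1,\dots,u_n\}$, $\overline v=\{v_1,\dots,v_m\}$; $j\notin K$ means $j$ lies in the complement of $K$ in the index set over which subsets are taken. The trigonometric source functions are $$F_{n,m}^{trig(z)}(\overline u|\overline v)=\sum_{K\subset[1,\dots,m]}(-z)^{|K|}q^{|K|(|K|-1)/2}\prod_{i\in K,\,j\notin K}\frac{v_i-qv_j}{v_i-v_j}\prod_{i\in K,\,1\le k\le n}\frac{v_i-u_k}{v_i-qu_k},$$ $$G_{n,m}^{trig(z)}(\overline u|\overline v)=\frac{(z;q)_\infty}{(q^{m-n}z;q)_\infty}\sum_{K\subset[1,\dots,n]}(-q^{m-n}z)^{|K|}q^{|K|(|K|-1)/2}\prod_{i\in K,\,j\notin K}\frac{qu_i-u_j}{u_i-u_j}\prod_{i\in K,\,1\le k\le m}\frac{v_k-u_i}{v_k-qu_i}.$$ ''In general position'' means $q\neq0$ and that zeros of all factors in denominators are avoided. *)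

(* Defs.v *)
From mathcomp Require Import all_boot all_order all_algebra.

Set Implicit Arguments.
Unset Strict Implicit.
Unset Printing Implicit Defensive.

Import GRing.Theory.
Local Open Scope ring_scope.

(* The ratio (z;q)_oo / (q^(m-n) z;q)_oo, which is a finite product. *)
Definition qpoch_ratio (C : fieldType) (n m : nat) (q z : C) : C :=
  if (n < m)%N then \prod_(0 <= j < m - n) (1 - q ^+ j * z)
  else if n == m then 1
  else (\prod_(1 <= j < (n - m).+1) (1 - q ^- j * z))^-1.

Definition Ftrig (C : fieldType) (n m : nat) (q z : C)
    (u : 'I_n -> C) (v : 'I_m -> C) : C :=
  \sum_(K : {set 'I_m})
    (- z) ^+ #|K| * q ^+ ((#|K| * (#|K| - 1)) %/ 2)
    * (\prod_(i in K) \prod_(j in ~: K) ((v i - q * v j) / (v i - v j)))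
    * (\prod_(i in K) \prod_(k < n) ((v i - u k) / (v i - q * u k))).

(* The exponent m - n may be negative, hence the integer power. *)
Definition Gtrig (C : fieldType) (n m : nat) (q z : C)
    (u : 'I_n -> C) (v : 'I_m -> C) : C :=
  qpoch_ratio n m q z *
  \sum_(K : {set 'I_n})
    (- (q ^ (m%:Z - n%:Z) * z)) ^+ #|K| * q ^+ ((#|K| * (#|K| - 1)) %/ 2)
    * (\prod_(i in K) \prod_(j in ~: K) ((q * u i - u j) / (u i - u j)))
    * (\prod_(i in K) \prod_(k < m) ((v k - u i) / (v k - q * u i))).

(* General position: q != 0 and no factor of a denominator vanishes. The
   auxiliary parameters eta only occur in denominators through their
   differences, so for them general position is injectivity. *)
Definition F_general_position (C : fieldType) (n m : nat) (q : C)
    (u : 'I_n -> C) (v : 'I_m -> C) : Prop :=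
  [/\ q != 0,
      injective v
    & forall (i : 'I_m) (k : 'I_n), v i - q * u k != 0].

(* The last condition concerns qpoch_ratio and is vacuous unless m < n. *)
Definition G_general_position (C : fieldType) (n m : nat) (q z : C)
    (u : 'I_n -> C) (v : 'I_m -> C) : Prop :=
  [/\ q != 0,
      injective u,
      forall (k : 'I_m) (i : 'I_n), v k - q * u i != 0
    & forall j : nat, (1 <= j <= n - m)%N -> 1 - q ^- j * z != 0].

(* Main.v *)
Require Import Defs.
From mathcomp Require Import all_boot all_order all_algebra.
From mathcomp Require Import reals complex.
From mathcomp Require Import ring zify.

Set Implicit Arguments.
Unset Strict Implicit.
Unset Printing Implicit Defensive.

Import GRing.Theory.
Local Open Scope ring_scope.

(** Both formulas come from one expansion. Each row of the determinant is a
    sum of two scalar multiples of rows [prod_(k != j) (y - eta_k)], with the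
    node [y] equal to [x_i] or to [p * x_i]; for (II) [p = q], and for (I)
    [p = q^-1] after pulling [q] out of every factor
    [v_i - q * eta_k]. Multilinearity in the rows turns the determinant into a
    sum over the set [K] of rows where the dilated node is chosen.

    Each term is the determinant of the matrix of values of the Lagrange
    polynomials [prod_(k != j) (X - eta_k)], which factors as
    [prod_(i < j) (y_j - y_i) (eta_i - eta_j)] ([det_lagrange]). Dividing by the
    undilated product cancels [eta] altogether, and what remains of the
    Vandermonde product in [y] is a factor [p] for every pair inside [K] and a
    factor [(p x_i - x_j) / (x_i - x_j)] for every pair that [K] separates
    ([vandermonde_dilate]). This is the summand of the source functions
    ([det_lagrange_expansion]). *)

(** * Determinants of evaluated Lagrange polynomials *)

Section LagrangeDeterminant.

Variable C : fieldType.

(** The matrix is the transposed Vandermonde matrix of [y] times the matrix of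
    coefficients of the Lagrange polynomials. The determinant of the latter
    depends on [eta] only, and is found from the case [y = eta], where the
    matrix is diagonal. *)
Lemma det_lagrange n (y eta : 'I_n -> C) : injective eta ->
  \det (\matrix_(i < n, j < n) \prod_(k < n | k != j) (y i - eta k))
  = \prod_(i < n) \prod_(j < n | (i < j)%N) (y j - y i)
    * \prod_(i < n) \prod_(j < n | (i < j)%N) (eta i - eta j).
Proof.
move=> eta_inj.
pose P (j : 'I_n) : {poly C} := \prod_(k < n | k != j) ('X - (eta k)%:P).
have sizeP j : size (P j) = n.
  have -> : P j = \prod_(k <- enum (predC1 j)) ('X - (eta k)%:P).
    by rewrite big_enum.
  rewrite size_prod_XsubC -cardE cardC1 card_ord prednK //.
  exact: leq_ltn_trans (leq0n j) (ltn_ord j).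
pose A : 'M[C]_n := \matrix_(k < n, j < n) (P j)`_k.
have factor (x : 'I_n -> C) :
    \matrix_(i < n, j < n) \prod_(k < n | k != j) (x i - eta k)
    = (Vandermonde n (\row_i x i))^T *m A.
  apply/matrixP => i j; rewrite !mxE.
  transitivity (P j).[x i].
    by rewrite horner_prod; apply: eq_bigr => k _; rewrite !hornerE.
  rewrite horner_coef sizeP; apply: eq_bigr => k _.
  by rewrite !mxE mulrC.
have detV (x : 'I_n -> C) : \det (Vandermonde n (\row_i x i))
    = \prod_(i < n) \prod_(j < n | (i < j)%N) (x j - x i).
  rewrite det_Vandermonde; apply: eq_bigr => i _; apply: eq_bigr => j _.
  by rewrite !mxE.
have detA : \det A = \prod_(i < n) \prod_(j < n | (i < j)%N) (eta i - eta j).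
  have V_neq0 : \det (Vandermonde n (\row_i eta i)) != 0.
    rewrite detV; apply/prodf_neq0 => i _; apply/prodf_neq0 => j ltij.
    rewrite subr_eq0; apply: contraTneq ltij => /eta_inj ->.
    by rewrite ltnn.
  apply: (mulfI V_neq0); rewrite -{1}det_tr -det_mulmx -factor detV.
  rewrite det_trig; last first.
    apply/is_trig_mxP => i j ltij; rewrite mxE (bigD1 i) /=.
      by rewrite subrr mul0r.
    by rewrite neq_ltn ltij.
  under eq_bigr do rewrite mxE.
  rewrite [LHS](_ : _ = \prod_(i < n) ((\prod_(k < n | (i < k)%N) (eta i - eta k))
     * \prod_(k < n | (k < i)%N) (eta i - eta k))); last first.
    apply: eq_bigr => i _; rewrite (bigID (fun k : 'I_n => (i < k)%N)) /=.
    by congr (_ * _); apply: eq_bigl => k; rewrite -val_eqE /=; lia.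
  rewrite big_split /= mulrC; congr (_ * _).
  by rewrite (exchange_big_dep xpredT).
by rewrite factor det_mulmx det_tr detV detA.
Qed.

(** Multilinearity of the determinant in the rows, for all rows at once. *)
Lemma det_row_add n (A B : 'M[C]_n) :
  \det (A + B)
  = \sum_(K : {set 'I_n})
      \det (\matrix_(i < n, j < n) if i \in K then B i j else A i j).
Proof.
rewrite /determinant exchange_big /=; apply: eq_bigr => s _.
under eq_bigr do rewrite mxE addrC.
rewrite bigA_distr mulr_sumr; apply: eq_bigr => K _; congr (_ * _).
by apply: eq_bigr => i _; rewrite mxE.
Qed.

Lemma det_row_scale n (c : 'I_n -> C) (A : 'I_n -> 'I_n -> C) :
  \det (\matrix_(i < n, j < n) (c i * A i j))
  = \prod_(i < n) c i * \det (\matrix_(i < n, j < n) A i j).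
Proof.
rewrite /determinant mulr_sumr; apply: eq_bigr => s _.
under eq_bigr do rewrite mxE.
under [in RHS]eq_bigr do rewrite mxE.
by rewrite big_split /= mulrCA.
Qed.

End LagrangeDeterminant.

(** * Dilating a subset of the nodes *)

Lemma sum_ordered_pairs n (K : {set 'I_n}) :
  (\sum_(i < n) \sum_(j < n | i < j) ((i \in K) && (j \in K)))%N
  = ((#|K| * (#|K| - 1)) %/ 2)%N.
Proof.
set S := LHS.
have cardK : (\sum_(i < n) (i \in K))%N = #|K|.
  by rewrite -sum1_card [RHS]big_mkcond; apply: eq_bigr => i _; case: (i \in K).
(* Counting all pairs of K: the pairs i < j, the pairs j < i, the diagonal. *)
have : (#|K| * #|K| = S + S + #|K|)%N.
  rewrite -{1 2 3}cardK big_distrl /= {2}/S (exchange_big_dep xpredT) //=.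
  rewrite -!big_split /=; apply: eq_bigr => i _.
  rewrite big_distrr /= (bigID (fun j : 'I_n => i < j)%N) /= -addnA; congr (_ + _)%N.
    by apply: eq_bigr => j _; case: (i \in K); case: (j \in K).
  rewrite (bigD1 i) ?ltnn //= addnC; congr (_ + _)%N; last by case: (i \in K).
  apply: eq_big => [j|j _]; first by rewrite -val_eqE /=; lia.
  by case: (i \in K); case: (j \in K).
by move=> ?; nia.
Qed.

Section Dilation.

Variable C : fieldType.

(** The ratio [(y_j - y_i) / (x_j - x_i)] is symmetric in [i] and [j]. Hence a
    pair separated by [K] contributes the same factor whichever of its elements
    lies in [K], and the product over such pairs [i < j] is the product over
    [K] and its complement. *)
Lemma vandermonde_dilate n (p : C) (x : 'I_n -> C) (K : {set 'I_n}) :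
    injective x ->
  let y i := if i \in K then p * x i else x i in
  \prod_(i < n) \prod_(j < n | (i < j)%N) (y j - y i)
  = \prod_(i < n) \prod_(j < n | (i < j)%N) (x j - x i)
    * (p ^+ ((#|K| * (#|K| - 1)) %/ 2)
       * \prod_(i in K) \prod_(j in ~: K) ((p * x i - x j) / (x i - x j))).
Proof.
move=> x_inj y.
pose c i j := (p * x i - x j) / (x i - x j).
(* [d i j * d j i] is the factor of a separated pair, in either order. *)
pose d i j := if (i \in K) && (j \notin K) then c i j else 1.
have pairE (i j : 'I_n) : (i < j)%N ->
    y j - y i = (x j - x i) * (p ^+ ((i \in K) && (j \in K)) * (d i j * d j i)).
  move=> ltij; have neq : i != j by rewrite neq_ltn ltij.
  have xij : x i - x j != 0 by rewrite subr_eq0 (inj_eq x_inj).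
  have xji : x j - x i != 0 by rewrite subr_eq0 (inj_eq x_inj) eq_sym.
  rewrite /y /d /c; case: (i \in K); case: (j \in K) => /=; field;
    by rewrite ?xij ?xji.
have splitted : \prod_(i in K) \prod_(j in ~: K) c i j
    = \prod_(i < n) \prod_(j < n | (i < j)%N) (d i j * d j i).
  transitivity (\prod_(i < n) \prod_(j < n) d i j).
    rewrite big_mkcond; apply: eq_bigr => i _; rewrite /d.
    case: (i \in K) => /=; last by rewrite big1.
    by rewrite big_mkcond; apply: eq_bigr => j _; rewrite inE.
  transitivity (\prod_(i < n) ((\prod_(j < n | (i < j)%N) d i j)
                               * \prod_(j < n | (j < i)%N) d i j)).
    apply: eq_bigr => i _; rewrite (bigID (fun j : 'I_n => i < j)%N) /=.
    congr (_ * _); rewrite (bigID (fun j => j == i)) /= big1 ?mul1r.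
      by apply: eq_bigl => j; rewrite -val_eqE /=; lia.
    by move=> j /andP[_ /eqP->]; rewrite /d andbN.
  rewrite big_split /= [X in _ * X](exchange_big_dep xpredT) //= -big_split /=.
  by apply: eq_bigr => i _; rewrite big_split.
rewrite splitted -sum_ordered_pairs expr_sum -!big_split /=.
apply: eq_bigr => i _; rewrite expr_sum -!big_split /=.
by apply: eq_bigr => j /pairE.
Qed.

(** The scalar [p] stays free because the two formulas need [q] and [q^-1]; the
    weights [w] stay free because the remaining factors depend on the row
    only. *)
Lemma det_lagrange_expansion n (p : C) (x eta w : 'I_n -> C) :
    injective x -> injective eta ->
  (\prod_(i < n) \prod_(j < n | (i < j)%N)
     ((x j - x i) * (eta i - eta j)))^-1
  * \det (\matrix_(i < n, j < n)
      (\prod_(k < n | k != j) (x i - eta k)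
       - w i * \prod_(k < n | k != j) (p * x i - eta k)))
  = \sum_(K : {set 'I_n})
      \prod_(i in K) (- w i) * p ^+ ((#|K| * (#|K| - 1)) %/ 2)
      * \prod_(i in K) \prod_(j in ~: K) ((p * x i - x j) / (x i - x j)).
Proof.
move=> x_inj eta_inj; set D := \prod_(i < n) _.
have D_neq0 : D != 0.
  apply/prodf_neq0 => i _; apply/prodf_neq0 => j ltij.
  have neq : i != j by rewrite neq_ltn ltij.
  by rewrite mulf_neq0 // subr_eq0 inj_eq // eq_sym.
have DE : D = \prod_(i < n) \prod_(j < n | (i < j)%N) (x j - x i)
              * \prod_(i < n) \prod_(j < n | (i < j)%N) (eta i - eta j).
  by rewrite -big_split; apply: eq_bigr => i _; rewrite big_split.
apply: (mulfI D_neq0); rewrite mulVKf //.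
pose A := \matrix_(i < n, j < n) \prod_(k < n | k != j) (x i - eta k).
pose B := \matrix_(i < n, j < n)
  (- w i * \prod_(k < n | k != j) (p * x i - eta k)).
rewrite (_ : \matrix_(i, j) _ = A + B); last first.
  by apply/matrixP => i j; rewrite !mxE mulNr.
rewrite det_row_add mulr_sumr; apply: eq_bigr => K _.
pose y i := if i \in K then p * x i else x i.
rewrite (_ : \matrix_(i, j) _ = \matrix_(i < n, j < n)
   ((if i \in K then - w i else 1) * \prod_(k < n | k != j) (y i - eta k))).
  rewrite det_row_scale det_lagrange // -big_mkcond /=.
  by rewrite (vandermonde_dilate p K x_inj) DE; ring.
by apply/matrixP => i j; rewrite !mxE /y; case: (i \in K); rewrite ?mul1r.
Qed.

(** * Determinant formulas for the source functions *)

(** Here [p = q^-1]. Each row in [K] brings a power [q ^+ (m - 1)], that is, one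
    [q] for every ordered pair of distinct rows whose first row lies in [K].
    Every unordered pair that meets [K] costs one [q^-1]. A pair inside [K] is
    counted twice by the former and once by the latter, so that it keeps one
    factor [q]; a pair separated by [K] keeps none. *)
Lemma Ftrig_det m n (q z : C) (u : 'I_n -> C) (v eta : 'I_m -> C) :
    q != 0 -> injective v -> injective eta ->
  Ftrig q z u v =
    (\prod_(i < m) \prod_(j < m | (i < j)%N)
       ((v j - v i) * (eta i - eta j)))^-1
    * \det (\matrix_(i < m, j < m)
        ((\prod_(k < m | k != j) (v i - eta k))
         - z * (\prod_(k < m | k != j) (v i - q * eta k))
             * (\prod_(k < n) ((v i - u k) / (v i - q * u k))))).
Proof.
move=> q0 v_inj eta_inj.
pose t i := \prod_(k < n) ((v i - u k) / (v i - q * u k)).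
have -> : \matrix_(i < m, j < m)
    (\prod_(k < m | k != j) (v i - eta k)
     - z * (\prod_(k < m | k != j) (v i - q * eta k)) * t i)
  = \matrix_(i < m, j < m)
    (\prod_(k < m | k != j) (v i - eta k)
     - q ^+ m.-1 * z * t i * \prod_(k < m | k != j) (q^-1 * v i - eta k)).
  apply/matrixP => i j; rewrite !mxE; congr (_ - _).
  have -> : \prod_(k < m | k != j) (v i - q * eta k)
      = q ^+ m.-1 * \prod_(k < m | k != j) (q^-1 * v i - eta k).
    rewrite (eq_bigr (fun k => q * (q^-1 * v i - eta k))) => [|k _].
      by rewrite big_split /= prodr_const cardC1 card_ord.
    by rewrite mulrBr mulVKf.
  by ring.
rewrite det_lagrange_expansion //; apply: eq_bigr => K _.
have -> : \prod_(i in K) - (q ^+ m.-1 * z * t i)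
    = q ^+ (m.-1 * #|K|) * ((- z) ^+ #|K| * \prod_(i in K) t i).
  rewrite exprM -!prodr_const -!big_split /=.
  by apply: eq_bigr => i _; ring.
have -> : \prod_(i in K) \prod_(j in ~: K) ((q^-1 * v i - v j) / (v i - v j))
    = q ^- (#|~: K| * #|K|)
      * \prod_(i in K) \prod_(j in ~: K) ((v i - q * v j) / (v i - v j)).
  rewrite -exprVn exprM -prodr_const -big_split /=; apply: eq_bigr => i _.
  rewrite -prodr_const -big_split /=; apply: eq_bigr => j _.
  by rewrite mulrA mulrBr mulKf.
have qE : q ^+ (m.-1 * #|K|)
    = q ^+ ((#|K| * (#|K| - 1)) %/ 2) * q ^+ ((#|K| * (#|K| - 1)) %/ 2)
      * q ^+ (#|~: K| * #|K|).
  rewrite -!exprD; congr (q ^+ _).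
  have := cardsC K; rewrite card_ord; move: #|K| #|~: K| => k l cardE.
  have even_pairs : (2 %| k * (k - 1))%N.
    by rewrite subn1 dvdn2 oddM; case: k cardE => //= k _; rewrite andNb.
  rewrite addnn -muln2 divnK // -cardE.
  by case: k {cardE even_pairs} => [|k]; lia.
rewrite qE exprVn; field.
by rewrite !expf_neq0.
Qed.

Lemma Gtrig_det m n (q z : C) (u eta : 'I_n -> C) (v : 'I_m -> C) :
    injective u -> injective eta ->
  Gtrig q z u v =
    qpoch_ratio n m q z
    * (\prod_(i < n) \prod_(j < n | (i < j)%N)
         ((u j - u i) * (eta i - eta j)))^-1
    * \det (\matrix_(i < n, j < n)
        ((\prod_(k < n | k != j) (u i - eta k))
         - q ^ (m%:Z - n%:Z) * z
             * (\prod_(k < n | k != j) (q * u i - eta k))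
             * (\prod_(k < m) ((u i - v k) / (q * u i - v k))))).
Proof.
move=> u_inj eta_inj; rewrite /Gtrig -[RHS]mulrA; congr (_ * _).
set a := q ^ _ * z.
pose t i := \prod_(k < m) ((u i - v k) / (q * u i - v k)).
rewrite (_ : \matrix_(i, j) _ = \matrix_(i < n, j < n)
    (\prod_(k < n | k != j) (u i - eta k)
     - a * t i * \prod_(k < n | k != j) (q * u i - eta k))); last first.
  by apply/matrixP => i j; rewrite !mxE mulrAC.
rewrite det_lagrange_expansion //; apply: eq_bigr => K _.
have -> : \prod_(i in K) - (a * t i)
    = (- a) ^+ #|K|
      * \prod_(i in K) \prod_(k < m) ((v k - u i) / (v k - q * u i)).
  rewrite -prodr_const -big_split /=; apply: eq_bigr => i _.
  rewrite -mulNr; congr (_ * _); apply: eq_bigr => k _.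
  by rewrite -[in LHS]opprB -[q * u i - v k]opprB invrN mulrNN.
by ring.
Qed.

End Dilation.

Theorem corollary3p6 (R : realType) (m n : nat) (hm : (0 < m)%N) (hn : (0 < n)%N)
    (q z : R[i]) (u : 'I_n -> R[i]) (v : 'I_m -> R[i]) :
  (F_general_position q u v ->
   forall eta : 'I_m -> R[i], injective eta ->
     Ftrig q z u v =
       (\prod_(i < m) \prod_(j < m | (i < j)%N)
          ((v j - v i) * (eta i - eta j)))^-1
       * \det (\matrix_(i < m, j < m)
           ((\prod_(k < m | k != j) (v i - eta k))
            - z * (\prod_(k < m | k != j) (v i - q * eta k))
                * (\prod_(k < n) ((v i - u k) / (v i - q * u k))))))
  /\
  (G_general_position q z u v ->
   forall eta : 'I_n -> R[i], injective eta ->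
     Gtrig q z u v =
       qpoch_ratio n m q z
       * (\prod_(i < n) \prod_(j < n | (i < j)%N)
            ((u j - u i) * (eta i - eta j)))^-1
       * \det (\matrix_(i < n, j < n)
           ((\prod_(k < n | k != j) (u i - eta k))
            - q ^ (m%:Z - n%:Z) * z
                * (\prod_(k < n | k != j) (q * u i - eta k))
                * (\prod_(k < m) ((u i - v k) / (q * u i - v k)))))).
Proof.
split=> [[q_neq0 v_inj _] | [_ u_inj _ _]] eta eta_inj.
  exact: Ftrig_det.
exact: Gtrig_det.
Qed.
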